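(* Let $p$ be a prime with $p \equiv 2 \pmod 3$, write $p = 3k+2$, and let $G$ be a finite abelian group of type I$(p)$. For an integer $t$ with $0 \le t \le 2|G|/(7p)$, say that $A \subseteq G$ is a *$t$-standard set* if there are a surjective homomorphism $\varphi \colon G \to \mathbb{Z}_p$ and a sum-free set $A' \subseteq \varphi^{-1}(\{k\})$ with $|A'| = t$ such that $$A = \varphi^{-1}(\{k+1, \ldots, 2k+1\}) \cup A'.$$ (a) For every integer $t$ with $0 \le t \le 2|G|/(7p)$, every $t$-standard set $A \subseteq G$ satisfies $$\mathrm{ST}(A) = \frac{3t|G|}{p} + \mathbf{1}[p \ne 2]\cdot t^2 .$$ (b) There exists a positive absolute constant $\delta$ (independent of $p$, $G$ and $t$) such that if $0 \le t \le \delta|G|/p$ and $A \subseteq G$ has exactly $\left(\frac13 + \frac1{3p}\right)|G| + t$ elements and satisfies $\mathrm{ST}(A) = \frac{3t|G|}{p} + \mathbf{1}[p \ne 2]\cdot t^2$, then $A$ is a $t$-standard set.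
   Context: A finite abelian group $G$ is of type I$(p)$, where $p$ is a prime with $p \equiv 2 \pmod 3$, if $p$ is the smallest among the prime factors $q$ of $|G|$ satisfying $q \equiv 2 \pmod 3$. For a subset $A$ of a finite abelian group, $\mathrm{ST}(A) = |\{(x,y,z) \in A^3 : x+y=z\}|$ is the number of (ordered) Schur triples contained in $A$ (elements not necessarily distinct). A set is sum-free if it contains no $x,y,z$ (not necessarily distinct) with $x+y=z$. $\mathbf{1}[p\neq 2]$ equals $1$ if $p \ne 2$ and $0$ if $p = 2$. *)

(* Defs.v *)
From HB Require Import structures.
From mathcomp Require Import all_boot all_order all_algebra.
From mathcomp Require Import reals.

Set Implicit Arguments.
Unset Strict Implicit.
Unset Printing Implicit Defensive.

Import Order.TTheory GRing.Theory Num.Theory.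
Local Open Scope ring_scope.

Definition typeI (p : nat) (G : finZmodType) : Prop :=
  [/\ prime p, p = 2 %[mod 3], (p %| #|G|)%N
    & forall q : nat, prime q -> (q %| #|G|)%N -> q = 2 %[mod 3] -> (p <= q)%N].

Definition ST (G : finZmodType) (A : {set G}) : nat :=
  #|[set w : G * G * G |
      [&& w.1.1 \in A, w.1.2 \in A, w.2 \in A & w.1.1 + w.1.2 == w.2]]|.

Definition sum_free (G : finZmodType) (A : {set G}) : Prop :=
  forall x y z : G, x \in A -> y \in A -> z \in A -> x + y <> z.

(* The inequalities compare the representatives in {0, ..., p-1}. This is the  *)
(* intended set of residues because 2k+1 < p when p = 3k+2.                    *)
Definition middle_residues (p k : nat) : {set 'Z_p} :=
  [set u : 'Z_p | (k + 1 <= u <= 2 * k + 1)%N].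

(* Meant for p a prime with p = 3k+2; the range of t is part of the notion.    *)
Definition standard_set (R : realType) (p k : nat) (G : finZmodType) (t : nat)
    (A : {set G}) : Prop :=
  t%:R <= 2 * #|G|%:R / (7 * p%:R) :> R /\
  exists (phi : {additive G -> 'Z_p}) (A' : {set G}),
    [/\ forall u : 'Z_p, exists x : G, phi x = u,
        A' \subset phi @^-1: [set k%:R],
        sum_free A',
        #|A'| = t
      & A = phi @^-1: middle_residues p k :|: A'].

(* Main.v *)
Require Import Defs.
From HB Require Import structures.
From mathcomp Require Import all_boot all_order all_fingroup all_algebra.
From mathcomp Require Import cyclic reals zify ring lra.

Set Implicit Arguments.
Unset Strict Implicit.
Unset Printing Implicit Defensive.

Import Order.TTheory GRing.Theory Num.Theory.
Local Open Scope ring_scope.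

(** Write [n = #|G|] and [m = n / p], so that [n = (3k + 2) m] and the set [A]
    of the second part has [(k + 1) m + t] elements, hence [3 #|A| = n + m + 3t].

    The first part is a count.  No sum of two middle classes is a middle class,
    an element of the class [k] belongs to exactly [3 m] triples whose other two
    elements are in middle classes, and two elements of the class [k] have their
    sum in a middle class unless [k = 0] ([ST_middle_union]).

    For the second part, [A] has so few Schur triples that all but at most
    [m / 11] of its elements [z] have low degree, in that fewer than [m / 3] of
    the [b] in [A] satisfy [z + b] in [A].  The elements of low degree
    form a sum-free set [A0] ([low_degree_sum_free]): if [x], [y] and [x + y]
    had low degree, the sets [A], [x + A] and [x + y + A] would be too nearly
    disjoint to fit into [G].  This is what makes the constant independent of
    [p].

    As [3 #|A0| > n], the set [A0] is rigid.  The isoperimetric method gives a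
    subgroup [H] that minimises [#|H + A0| - #|H|] ([atom_subgroup]), and [A0 + H]
    is sum-free with [3 #|A0 + H| = n + #|H|] ([sum_free_hull]).  So the index of
    [H] is [2] modulo [3]; the size of [A0] makes it less than [2 p], and it is
    therefore a prime [q >= p].  In the cyclic group [G / H] the image of [A0] is
    a sum-free set of [(q + 1) / 3] residues; a counting argument for sets with
    critical sumset shows that it is a progression ([sum_free_progression]),
    which a dilation turns into the middle interval ([sum_free_middle]).

    Hence [A] is close to a preimage [M] of the middle residues modulo [q].
    Let [X = A - M], [Y = M - A] and [K = n / q].  An element of [X] lies in at
    least [3 K] triples with two elements of [M], and in at least [6 K] of them
    unless its class is [k] or [- k], where now [q = 3k + 2]; if [q] is not [2],
    pairs of elements of [X] in these two classes yield further triples, more of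
    them if both classes occur; and passing from [M] to [A] loses at most
    [9 #|X| #|Y|] of all these ([ST_lower_bound_pairs]).  Compared with the number of triples that [A] has,
    this leaves no room for [q > p], for elements of [Y], for other classes in
    [X] or for both classes at once ([excess_arith]). *)

(** * Sumsets and atoms *)

Ltac card_lia := clear; repeat match goal with
  | |- context [@card.body ?T ?X] => generalize (@card.body T X); intro
  end; lia.

Definition sumset (G : finZmodType) (X Y : {set G}) : {set G} :=
  [set x + y | x in X, y in Y].

Definition shift (G : finZmodType) (c : G) (X : {set G}) : {set G} :=
  [set c + x | x in X].

Definition oppset (G : finZmodType) (X : {set G}) : {set G} :=
  [set - x | x in X].

Section Sumsets.
Variable G : finZmodType.
Implicit Types (X Y A H : {set G}) (x y c : G).

Lemma sumsetP X Y z :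
  reflect (exists x y, [/\ x \in X, y \in Y & z = x + y]) (z \in sumset X Y).
Proof.
apply: (iffP imset2P) => [[x y Xx Yy ->]|[x [y [Xx Yy ->]]]]; first by exists x, y.
by exists x y.
Qed.

Lemma mem_sumset X Y x y : x \in X -> y \in Y -> x + y \in sumset X Y.
Proof. by move=> Xx Yy; apply/sumsetP; exists x, y. Qed.

Lemma mem_shift c X x : (x \in shift c X) = (x - c \in X).
Proof.
apply/imsetP/idP => [[y Xy ->]|Xxc]; first by rewrite addrC addKr.
by exists (x - c); rewrite // addrC subrK.
Qed.

Lemma card_shift c X : #|shift c X| = #|X|.
Proof. by apply: card_imset; apply: addrI. Qed.

Lemma card_setT : #|[set: G]| = #|G|.
Proof. exact: cardsT. Qed.

Lemma mem_oppset X x : (x \in oppset X) = (- x \in X).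
Proof.
apply/imsetP/idP => [[y Xy ->]|Xx]; first by rewrite opprK.
by exists (- x); rewrite ?opprK.
Qed.

Lemma card_oppset X : #|oppset X| = #|X|.
Proof. by apply: card_imset; apply: oppr_inj. Qed.

Lemma sumsetC X Y : sumset X Y = sumset Y X.
Proof.
by apply/setP=> z; apply/sumsetP/sumsetP=> -[x [y [Xx Yy ->]]];
  exists y, x; rewrite addrC.
Qed.

Lemma sumset_shift c X Y : sumset (shift c X) Y = shift c (sumset X Y).
Proof.
apply/setP=> z; rewrite mem_shift; apply/sumsetP/sumsetP.
  move=> [x [y [Xx Yy ->]]]; exists (x - c), y; rewrite -mem_shift; split=> //.
  by rewrite addrAC.
move=> [x [y [Xx Yy /(canRL (subrK c)) ->]]]; exists (x + c), y; split=> //.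
  by rewrite mem_shift addrK.
by rewrite addrAC.
Qed.

Lemma sumsetSl X X' Y : X \subset X' -> sumset X Y \subset sumset X' Y.
Proof. by move=> sX; apply: imset2S. Qed.

Lemma sumsetUl X X' Y : sumset (X :|: X') Y = sumset X Y :|: sumset X' Y.
Proof.
apply/setP=> z; rewrite inE; apply/sumsetP/orP.
  move=> [x [y [/setUP[Xx|Xx] Yy ->]]]; [left|right]; exact: mem_sumset.
by case=> /sumsetP[x [y [Xx Yy ->]]]; exists x, y; rewrite inE Xx ?orbT.
Qed.

Lemma leq_card_sumsetl X Y y : y \in Y -> (#|X| <= #|sumset X Y|)%N.
Proof.
move=> Yy; rewrite -(card_shift y); apply/subset_leq_card/subsetP => z.
by rewrite mem_shift => Xz; rewrite -(subrK y z); apply: mem_sumset.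
Qed.

(** Submodularity of the map that sends [X] to the size of [X + Y]. *)
Lemma sumset_submodular X X' Y :
  (#|sumset (X :&: X') Y| + #|sumset (X :|: X') Y|
     <= #|sumset X Y| + #|sumset X' Y|)%N.
Proof.
rewrite sumsetUl addnC -[leqRHS]cardsUI leq_add2l; apply: subset_leq_card.
by rewrite subsetI !sumsetSl ?subsetIl ?subsetIr.
Qed.

(** The isoperimetric method: among the sets [X] with [X + A] not everything
    that minimise [#|X + A| - #|X|], one of least cardinality is called an atom.
    If [X] is such a minimiser, so is the opposite of the complement of [X + A];
    hence an atom is too small for the sum of [A] with the union of two of its
    translates to be everything, and by submodularity distinct translates of an
    atom are disjoint.  The translate that contains [0] is then a subgroup. *)
Lemma atom_subgroup A X0 : X0 != set0 -> sumset X0 A != setT ->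
  exists H, [/\ zmod_closed H, sumset H A != setT &
    forall X, X != set0 -> sumset X A != setT ->
      (#|sumset H A| + #|X| <= #|sumset X A| + #|H|)%N].
Proof.
move=> X0n0 X0T; pose ok X := (X != set0) && (sumset X A != setT).
pose F X := (#|sumset X A| + (#|G| - #|X|))%N.
have okX0 : ok X0 by rewrite /ok X0n0.
case: (arg_minnP F okX0) => X1 okX1 minX1.
have okX1' : ok X1 && (F X1 == F X1) by rewrite okX1 eqxx.
case: (@arg_minnP _ X1 (fun X => ok X && (F X == F X1)) (fun X => #|X|) okX1').
move=> X /andP[okX /eqP FX] minX.
have leC (Y : {set G}) : (#|Y| <= #|G|)%N by apply: max_card.
have {}minF Y : ok Y -> (#|sumset X A| + #|Y| <= #|sumset Y A| + #|X|)%N.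
  move=> /minX1; rewrite -FX /F.
  by have := leC X; have := leC Y; lia.
have {}minX Y : ok Y -> (#|sumset Y A| + #|X| <= #|sumset X A| + #|Y|)%N ->
    (#|X| <= #|Y|)%N.
  move=> okY le; apply: minX; rewrite okY /= -FX /F.
  by have := minF _ okY; have := leC X; have := leC Y; lia.
have [Xn0 XT] := andP okX.
(* The opposite of the complement of [X + A] is a minimiser as well. *)
have small : (#|X| + #|sumset X A| <= #|G|)%N.
  have [Z defZ] : exists Z, Z = oppset (~: sumset X A) by eexists.
  have cZ : (#|sumset X A| + #|Z| = #|G|)%N by rewrite defZ card_oppset cardsC.
  have ZA : sumset Z A \subset ~: oppset X.
    apply/subsetP => _ /sumsetP[z [a [+ Aa ->]]].
    rewrite defZ mem_oppset !inE mem_oppset; apply: contra => Xx.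
    by rewrite -[- z](subrK a) -opprD mem_sumset.
  have cX : (#|X| + #|~: oppset X| = #|G|)%N by rewrite -(card_oppset X) cardsC.
  have := subset_leq_card ZA => leZ.
  have [x Xx] := set0Pn _ Xn0.
  have okZ : ok Z.
    apply/andP; split.
      rewrite -card_gt0; have : (#|sumset X A| < #|G|)%N.
        by rewrite -cardsT proper_card // properT.
      move: cZ; card_lia.
    apply: contraTneq ZA => ->; apply/subsetPn; exists (- x); rewrite ?inE //.
    by rewrite mem_oppset opprK negbK.
  have : (#|X| <= #|Z|)%N by apply: minX => //; move: leZ cX cZ; card_lia.
  by move: cZ; card_lia.
have disj c x : x \in X -> x \in shift c X -> shift c X = X.
  move=> Xx cx; apply/eqP; apply: contraT => ne.
  have cY : #|shift c X| = #|X| by rewrite card_shift.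
  have cYA : #|sumset (shift c X) A| = #|sumset X A|.
    by rewrite sumset_shift card_shift.
  move: (shift c X) cx ne cY cYA => Y cx ne cY cYA.
  have ltI : (#|X :&: Y| < #|X|)%N.
    rewrite ltn_neqAle subset_leq_card ?subsetIl // andbT.
    apply: contra ne => /eqP e; rewrite eq_sym eqEcard cY leqnn andbT.
    apply/setIidPl/eqP.
    by rewrite eqEcard subsetIl e leqnn.
  have okI : ok (X :&: Y).
    apply/andP; split; first by apply/set0Pn; exists x; rewrite inE Xx.
    apply: contra XT; rewrite -!subTset => /subset_trans-> //.
    by rewrite sumsetSl ?subsetIl.
  have subm := sumset_submodular X Y A; have cU := cardsUI X Y.
  have ltF : (#|sumset X A| + #|X :&: Y| < #|sumset (X :&: Y) A| + #|X|)%N.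
    by rewrite ltnNge; apply: contraL ltI => /(minX _ okI); rewrite -leqNgt.
  have [UT|UT] := eqVneq (sumset (X :|: Y) A) setT.
    by move: subm cYA small ltF; rewrite UT card_setT; card_lia.
  have okU : ok (X :|: Y).
    by rewrite /ok UT andbT; apply/set0Pn; exists x; rewrite inE Xx.
  by move: (minF _ okU) subm cY cYA ltF cU; card_lia.
have [x0 Xx0] := set0Pn _ Xn0; exists (shift (- x0) X); split.
- split=> [|x y]; first by rewrite mem_shift opprK add0r.
  rewrite !mem_shift !opprK => Xx Xy.
  have Xxy : x + x0 - (x - y) \in X by rewrite opprB addrC addrA subrK.
  by rewrite -(disj (x - y) (x + x0)) // mem_shift // addrC addKr.
- rewrite sumset_shift; apply: contra XT => /eqP e.
  by rewrite eqEcard subsetT -e card_shift /=.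
- move=> Y Yn0 YT; rewrite sumset_shift !card_shift; apply: minF.
  exact/andP.
Qed.

End Sumsets.

(** * Periodic hull of a large sum-free set *)

Section PeriodicHull.
Variable G : finZmodType.
Implicit Types (A H P : {set G}).

Lemma zmod_closedD H x y : zmod_closed H -> x \in H -> y \in H -> x + y \in H.
Proof. by move=> [H0 HB] Hx Hy; rewrite -[y]opprK HB // -sub0r HB. Qed.

(** A set that is invariant under [H] is a union of cosets of [H]. *)
Lemma card_periodic_dvd H P : zmod_closed H ->
  {in P & H, forall x h, x + h \in P} -> (#|H| %| #|P|)%N.
Proof.
move=> Hs PH; have [H0 HB] := Hs; pose f x := shift x H.
rewrite (@card_uniform_partition _ #|H| (preim_partition f P) P).
- exact: dvdn_mull.
- move=> _ /imsetP[x Px ->]; rewrite -(card_shift x H); congr #|pred_of_set _|.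
  apply/setP=> y; rewrite inE mem_shift; apply/andP/idP => [[Py /eqP e]|Hyx].
    by rewrite -mem_shift -[shift x H]/(f x) e mem_shift subrr.
  split; first by rewrite -[y](subrK x) addrC PH.
  apply/eqP/setP=> z; rewrite !mem_shift.
  apply/idP/idP => Hz; last by rewrite -(subrKA y) zmod_closedD.
  by rewrite -[z](subrK x) -addrA -[x - y]opprB HB.
- exact: preim_partitionP.
Qed.

Lemma card_subgroup_dvd H : zmod_closed H -> (#|H| %| #|G|)%N.
Proof. by move=> Hs; rewrite -card_setT; apply: card_periodic_dvd => // x h; rewrite !inE. Qed.

Lemma subset_hull A H : zmod_closed H -> A \subset sumset A H.
Proof.
by move=> [H0 _]; apply/subsetP=> x Ax; rewrite -[x]addr0 mem_sumset.
Qed.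

(** If [x], [y], [z] in [A] satisfied [x + y = z] modulo [H], with [x] and [z]
    in different cosets, then the translate by [y] of the part of [A] in
    [x + H] would lie in [z + H] outside [A], so that at least [#|H|] elements
    of these two cosets would be missing from [A]. *)
Lemma sum_in_hull A H x y z : zmod_closed H -> sum_free A ->
    (#|sumset A H| < #|A| + #|H|)%N ->
  x \in A -> y \in A -> z \in A -> x + y - z \in H -> x - z \in H.
Proof.
move=> Hs Asf ltAH Ax Ay Az Hxyz; have [H0 HB] := Hs.
apply: contraLR ltAH => nHxz; rewrite -leqNgt.
have subAH w : w \in A -> shift w H \subset sumset A H.
  move=> Aw; apply/subsetP => u; rewrite mem_shift => Hu.
  by rewrite -(subrK w u) addrC mem_sumset.
have dis : shift x H :&: shift z H = set0.
  apply/setP=> u; rewrite !inE !mem_shift; apply/negbTE.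
  apply: contra nHxz => /andP[Hux Huz].
  by rewrite -(subrKA u) addrC -[x - u]opprB HB.
have UV : (#|A :&: shift x H| + #|A :&: shift z H| <= #|H|)%N.
  rewrite -(card_shift y (A :&: shift x H)) -(card_shift z H) -cardsUI.
  have -> : shift y (A :&: shift x H) :&: (A :&: shift z H) = set0.
    apply/setP=> u; rewrite !inE mem_shift !inE; apply/negP => /and3P[/andP[Auy _] Au _].
    by apply: (Asf _ _ _ Ay Auy Au); rewrite addrC subrK.
  rewrite cards0 addn0; apply: subset_leq_card; rewrite subUset subsetIr andbT.
  apply/subsetP => u; rewrite mem_shift inE !mem_shift => /andP[_ Hu].
  have -> : u - z = (u - y - x) + (x + y - z).
    rewrite [x + y]addrC -(addrA y x) (addrA _ y) [u - y - x + y]addrAC.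
    by rewrite subrK addrA subrK.
  exact: zmod_closedD.
have cU : #|shift x H :|: shift z H| = (#|H| + #|H|)%N.
  by rewrite -{1}(card_shift x H) -(card_shift z H) -cardsUI dis cards0 addn0.
have sub : A :|: (shift x H :|: shift z H) \subset sumset A H.
  by rewrite !subUset subset_hull ?subAH.
have := subset_leq_card sub.
have := cardsUI A (shift x H :|: shift z H); rewrite cU setIUr.
have := cardsUI (A :&: shift x H) (A :&: shift z H).
move: UV; card_lia.
Qed.

(** The set [A] has fewer than [#|H|] holes in [A + H], where [H] is an atom of
    [A]; hence [A + H] is again sum-free, and the minimality of [H], now used
    for the set [A + H], bounds the number of its cosets. *)
Lemma sum_free_hull A : sum_free A -> (#|G| < 3 * #|A|)%N ->
  exists H, [/\ zmod_closed H, sum_free (sumset A H)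
    & (3 * #|sumset A H| = #|G| + #|H|)%N].
Proof.
move=> Asf ltGA.
have sfI (B X : {set G}) : sum_free B -> X \subset B -> (#|sumset X B| + #|B| <= #|G|)%N.
  move=> Bsf sXB; rewrite -cardsUI.
  have -> : sumset X B :&: B = set0.
    apply/setP=> u; rewrite !inE; apply/negP => /andP[/sumsetP[x [y [Xx By ->]]] Bxy].
    by apply: (Bsf _ _ _ (subsetP sXB _ Xx) By Bxy).
  by rewrite cards0 addn0; apply: max_card.
have An0 : A != set0 by rewrite -card_gt0; move: ltGA; card_lia.
have sfT (B X : {set G}) : B != set0 -> sum_free B -> X \subset B -> sumset X B != setT.
  move=> Bn0 Bsf sX; apply: contraTneq (sfI _ _ Bsf sX) => ->.
  by rewrite card_setT -ltnNge; move: Bn0; rewrite -card_gt0; card_lia.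
have [H [Hs HT minH]] := atom_subgroup An0 (sfT _ _ An0 Asf (subxx _)).
have ltAH : (#|sumset A H| < #|A| + #|H|)%N.
  rewrite sumsetC; have := minH A An0 (sfT _ _ An0 Asf (subxx _)).
  have := sfI _ _ Asf (subxx _); move: ltGA; card_lia.
have [H0 HB] := Hs.
have Psf : sum_free (sumset A H).
  move=> s1 s2 s3 /sumsetP[a [h [Aa Hh ->]]] /sumsetP[b [h' [Ab Hh' ->]]].
  move=> /sumsetP[c [h'' [Ac Hh'' ->]]] eq.
  have Habc : a + b - c \in H.
    have -> : a + b - c = h'' - (h + h').
      apply/eqP; rewrite subr_eq -addrA [_ + c]addrC addrA [h'' + c]addrC -eq.
      by rewrite addrACA addrK.
    by rewrite HB ?zmod_closedD.
  have Hac : a - c \in H := sum_in_hull Hs Asf ltAH Aa Ab Ac Habc.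
  have Hb : b \in H.
    by rewrite -[b](addKr (a - c)) addrC HB // addrAC.
  have AH : A \subset H.
    apply/subsetP => d Ad.
    have Hbw : b - d \in H by apply: (sum_in_hull Hs Asf ltAH Ab Ad Ad); rewrite ?addrK.
    by rewrite -[d](subKr b) HB.
  have : (2 * #|A| <= #|H|)%N.
    rewrite mul2n -addnn -{1}(card_shift b A) -cardsUI.
    have -> : shift b A :&: A = set0.
      apply/setP=> u; rewrite !inE mem_shift; apply/negP => /andP[Aub Au].
      by apply: (Asf _ _ _ Ab Aub Au); rewrite addrC subrK.
    rewrite cards0 addn0; apply: subset_leq_card; rewrite subUset AH andbT.
    apply/subsetP => u; rewrite mem_shift => Au.
    by rewrite -(subrK b u) zmod_closedD // (subsetP AH).
  have : (2 * #|H| <= #|G|)%N.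
    have /dvdnP[[|[|N]] eN] := card_subgroup_dvd Hs; last by move: eN; card_lia.
      by have : (#|A| <= #|G|)%N := max_card _; move: eN ltGA; card_lia.
    case/negP: HT; rewrite -subTset; apply/subsetP => u _.
    rewrite -(subrK a u) mem_sumset //.
    have -> : H = setT by apply/eqP; rewrite eqEcard subsetT card_setT eN mul1n leqnn.
    by rewrite inE.
  by move: ltGA; card_lia.
have sAP : A \subset sumset A H := subset_hull A Hs.
have Pn0 : sumset A H != set0.
  by apply: contraNneq An0 => P0; rewrite -subset0 -P0.
have := minH _ Pn0.
rewrite [sumset (sumset A H) A]sumsetC => /(_ (sfT _ _ Pn0 Psf sAP)) le1.
have le2 := sfI _ _ Psf sAP; rewrite [sumset H A]sumsetC in le1.
have le3 := subset_leq_card sAP.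
exists H; split=> //.
have /dvdnP[N eN] := card_subgroup_dvd Hs.
have /dvdnP[a ea] : (#|H| %| #|sumset A H|)%N.
  apply: card_periodic_dvd => // _ h /sumsetP[x [h' [Ax Hh' ->]]] Hh.
  by rewrite -addrA mem_sumset ?zmod_closedD.
have le4 : (N * #|H| < 3 * a * #|H|)%N by rewrite -eN -mulnA -ea; move: ltGA le3; card_lia.
have le5 : (3 * a * #|H| <= N.+1 * #|H|)%N.
  by rewrite (mulSn N) -eN -mulnA -ea; move: le1 le2; card_lia.
have hgt0 : (0 < #|H|)%N by apply/card_gt0P; exists 0.
rewrite ea eN mulnA addnC -mulSn; congr (_ * _)%N.
by rewrite !leq_pmul2r ?ltn_pmul2r // in le4 le5; lia.
Qed.

End PeriodicHull.

(** * Groups of prime order *)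

Section PrimeOrder.
Variable Q : finZmodType.
Hypothesis primeQ : prime #|Q|.
Implicit Types (X Y B : {set Q}).

(** A subgroup of a group of prime order is trivial, so an atom is a point. *)
Lemma cauchy_davenport X Y : X != set0 -> Y != set0 -> sumset X Y != setT ->
  (#|X| + #|Y| <= #|sumset X Y| + 1)%N.
Proof.
move=> Xn0 /set0Pn[y Yy] XYT; have [H [Hs HT minH]] := atom_subgroup Xn0 XYT.
have [H0 _] := Hs; have := minH X Xn0 XYT.
have := leq_card_sumsetl Y H0; rewrite sumsetC.
suff -> : #|H| = 1%N by card_lia.
have [_ /(_ _ (card_subgroup_dvd Hs))/orP[/eqP //|/eqP cH]] := primeP primeQ.
case/negP: HT; rewrite -subTset; apply/subsetP => u _.
rewrite -(subrK y u) mem_sumset //.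
have -> : H = setT by apply/eqP; rewrite eqEcard subsetT card_setT cH leqnn.
by rewrite inE.
Qed.

(** Call [X] critical if [#|X + B| = #|X| + #|B| - 1].  As [B] is critical, so
    are its opposite and the translates of it, and a critical set [M] of least
    size at least [2] meets such a translate in a critical set unless in at most
    one point.  So every [c - B] contains [M] or meets it in at most one point,
    and counting the pairs of [m] in [M] and [c] with [m] in [c - B] shows that
    [#|B| - 1] of these translates contain [M].  The difference of any two
    points of [M] is then the difference of the progression [B]. *)
Lemma sum_free_progression B : sum_free B -> (3 * #|B| = #|Q| + 1)%N ->
  (1 < #|B|)%N -> exists2 d, d != 0 & (#|B| <= #|B :&: shift d B| + 1)%N.
Proof.
move=> Bsf cB B_gt1.
have Bn0 : B != set0 by rewrite -card_gt0; move: B_gt1; card_lia.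
have crit_le X : (#|sumset X B| + #|B| <= #|Q|)%N ->
    X != set0 -> #|X| = #|B| -> (#|sumset X B| + 1 = #|X| + #|B|)%N.
  move=> le Xn0 cX; have XT : sumset X B != setT.
    by apply: contraTneq le => ->; rewrite card_setT; move: B_gt1; card_lia.
  have := cauchy_davenport Xn0 Bn0 XT; move: le cB; rewrite cX; card_lia.
have critB : (#|sumset B B| + 1 = #|B| + #|B|)%N.
  apply: crit_le => //; rewrite -cardsUI.
  have -> : sumset B B :&: B = set0.
    apply/setP=> u; rewrite !inE; apply/negP => /andP[/sumsetP[x [y [Bx By ->]]] Bxy].
    exact: (Bsf _ _ _ Bx By Bxy).
  by rewrite cards0 addn0; apply: max_card.
have critN c : (#|sumset (shift c (oppset B)) B| + 1 = #|B| + #|B|)%N.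
  rewrite sumset_shift card_shift -{1}(card_oppset B).
  apply: crit_le; rewrite ?card_oppset //; last first.
    by rewrite -card_gt0 card_oppset card_gt0.
  rewrite -cardsUI.
  have -> : sumset (oppset B) B :&: B = set0.
    apply/setP=> u; rewrite !inE; apply/negP => /andP[/sumsetP[x [y [Bx By ->]]] Bxy].
    rewrite mem_oppset in Bx; apply: (Bsf _ _ _ Bx Bxy By).
    by rewrite addKr.
  by rewrite cards0 addn0; apply: max_card.
pose crit (X : {set Q}) := [&& (1 < #|X|)%N, sumset X B != setT
                 & (#|sumset X B| + 1 == #|X| + #|B|)%N].
have critB' : crit B.
  rewrite /crit B_gt1 critB eqxx andbT; apply: contra_eq_neq critB => ->.
  rewrite card_setT; move: cB B_gt1; card_lia.
case: (arg_minnP (fun X => #|X|) critB') => M /and3P[gtM MT /eqP eqM] minM.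
have M_gt1 : (1 < #|M|)%N := gtM.
have critM : (#|sumset M B| + 1 = #|M| + #|B|)%N := eqM.
have MB := minM _ critB'.
have Mdich c : (1 < #|M :&: shift c (oppset B)|)%N -> M \subset shift c (oppset B).
  have cK : #|shift c (oppset B)| = #|B| by rewrite card_shift card_oppset.
  have := critN c; move: (shift c _) cK => K cK critK I_gt1.
  suff /minM leI : crit (M :&: K).
    by apply/setIidPl/eqP; rewrite eqEcard subsetIl leI.
  have IT : sumset (M :&: K) B != setT.
    apply: contra MT => /eqP eT.
    by rewrite -subTset -eT sumsetSl ?subsetIl.
  have In0 : M :&: K != set0 by rewrite -card_gt0; move: I_gt1; card_lia.
  suff leI : (#|sumset (M :&: K) B| + 1 <= #|M :&: K| + #|B|)%N.
    apply/and3P; split=> //; apply/eqP/anti_leq; rewrite leI.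
    exact: cauchy_davenport.
  have subm := sumset_submodular M K B; have cU := cardsUI M K.
  suff : (#|M :|: K| + #|B| <= #|sumset (M :|: K) B| + 1)%N.
    move: subm cU critM critK cK; card_lia.
  have [->|UT] := eqVneq (sumset (M :|: K) B) setT.
    rewrite card_setT; move: cB cU MB cK I_gt1; card_lia.
  apply: cauchy_davenport => //; apply: contraNneq In0 => U0.
  by rewrite -subset0 -U0 subIset ?subsetUl.
pose W := [set c | M \subset shift c (oppset B)].
have memK c m : (m \in shift c (oppset B)) = (c \in shift m B).
  by rewrite !mem_shift mem_oppset opprB.
have double : (\sum_(c : Q) #|M :&: shift c (oppset B)| = #|M| * #|B|)%N.
  under eq_bigr do rewrite -sum1_card.
  rewrite (exchange_big_dep (mem M)) /=; last by move=> c m _ /setIP[].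
  rewrite -sum_nat_const; apply: eq_bigr => m Mm.
  rewrite -(card_shift m B) -sum1_card; apply: eq_bigl => c.
  by rewrite inE Mm memK.
have upper : (#|M| * #|B| <= #|sumset M B| + #|W| * (#|M| - 1))%N.
  rewrite -double (bigID (mem (sumset M B))) /= [X in (_ + X)%N]big1 ?addn0; last first.
    move=> c nc; apply/eqP; rewrite cards_eq0; apply: contraNT nc => /set0Pn[m].
    rewrite inE memK mem_shift => /andP[Mm Bcm].
    by rewrite -(subrK m c) addrC mem_sumset.
  apply: (@leq_trans (\sum_(c in sumset M B) (1 + (c \in W) * (#|M| - 1)))%N).
    apply: leq_sum => c _; rewrite [c \in W]inE.
    have [Mc|nMc] := boolP (M \subset shift c (oppset B)).
      by rewrite (setIidPl Mc) mul1n subnKC // (ltnW M_gt1).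
    by rewrite mul0n addn0 leqNgt; apply: contra nMc => /Mdich.
  rewrite big_split /= sum1_card leq_add2l -big_distrl /= leq_mul2r; apply/orP; right.
  rewrite big_mkcond; apply: (@leq_trans (\sum_(c in W) 1)%N); last by rewrite sum1_card.
  rewrite [leqRHS]big_mkcond; apply: leq_sum => c _; do 2 case: ifP => // _.
have leW : (#|B| <= #|W| + 1)%N.
  have : ((#|M| - 1) * (#|B| - 1) <= (#|M| - 1) * #|W|)%N.
    move: upper critM M_gt1 B_gt1.
    move: #|M| #|B| #|W| #|sumset M B| => [|mu] [|b] w s; rewrite ?subn1 //=.
    by move=> *; nia.
  rewrite leq_pmul2l; move: M_gt1 B_gt1; card_lia.
have /card_gt1P[u [v [Mu Mv uv]]] := M_gt1.
exists (v - u); first by rewrite subr_eq0 eq_sym.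
apply: leq_trans leW _; rewrite leq_add2r -(card_shift (- u) W).
apply/subset_leq_card/subsetP => c; rewrite mem_shift opprK inE => sM.
have := subsetP sM _ Mu; have := subsetP sM _ Mv.
by rewrite !memK inE !mem_shift addrK opprB addrA => -> ->.
Qed.

End PrimeOrder.

(** * Sum-free intervals of residues *)

Section Residues.

(** Exactly one [b] in [B] has [b - 1] outside [B], so that the descent by [1]
    from any element of [B] stays in [B] until it reaches [b]. *)
Lemma interval_of_progression (q : nat) (B : {set 'Z_q}) : B != set0 -> B != setT ->
    (#|B| <= #|B :&: shift (1%R : 'Z_q) B| + 1)%N ->
  exists b : 'Z_q, B = [set b + (val i)%:R | i in 'I_#|B|].
Proof.
move=> Bn0 BT leB.
have cD : (#|B :\: shift (1%R : 'Z_q) B| <= 1)%N.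
  by move: leB; rewrite -{1}(cardsID (shift (1%R : 'Z_q) B) B) leq_add2l.
have [b Db] : exists b, b \in B :\: shift (1%R : 'Z_q) B.
  apply/set0Pn; apply: contra BT; rewrite setD_eq0 => /subsetP sB.
  have [x0 Bx0] := set0Pn _ Bn0.
  have Bj j : x0 - j%:R \in B.
    elim: j => [|j IHj]; first by rewrite subr0.
    by have := sB _ IHj; rewrite mem_shift mulrSr opprD addrA.
  rewrite -subTset; apply/subsetP => x _; rewrite -(subKr x0 x).
  by rewrite -(natr_Zp (x0 - x)) Bj.
have step x : x \in B -> x != b -> x - 1 \in B.
  move=> Bx; apply: contraNT => nBx.
  have Dx : x \in B :\: shift (1%R : 'Z_q) B by rewrite inE mem_shift nBx.
  by apply/eqP; have := card_le1_eqP cD; apply.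
exists b; apply/eqP; rewrite eqEcard; apply/andP; split; last first.
  apply: leq_trans (leq_imset_card _ _) _. by rewrite card_ord.
apply/subsetP => x Bx.
have ltq (m : nat) (y : 'Z_q) : (m <= y)%N -> val (m%:R : 'Z_q) = m.
  by move=> le; rewrite Zp_nat /= modn_small // (leq_ltn_trans le) ?ltn_ord.
have desc j : (j <= val (x - b)%R)%N -> x - j%:R \in B.
  elim: j => [|j IHj] lej; first by rewrite subr0.
  rewrite mulrSr opprD addrA step ?IHj ?(ltnW lej) //.
  have vj := ltq _ _ (ltnW lej); apply: contraTneq lej => eb.
  by rewrite -leqNgt -eb subKr vj.
have ltB : (val (x - b)%R < #|B|)%N.
  pose f (j : 'I_(val (x - b)%R).+1) := x - (val j)%:R.
  have injf : injective f.
    have vo (i : 'I_(val (x - b)%R).+1) := ltq (val i) (x - b) (ltn_ord i).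
    move=> i j /addrI/oppr_inj/(congr1 val) e; apply: val_inj.
    exact: etrans (esym (vo i)) (etrans e (vo j)).
  rewrite -[X in (X <= _)%N]card_ord -(card_imset _ injf).
  by apply/subset_leq_card/subsetP => _ /imsetP[j _ ->]; apply: desc; rewrite -ltnS ltn_ord.
have ex : x = b + (val (x - b)%R)%:R by rewrite natr_Zp addrC subrK.
by apply/imsetP; exists (Ordinal ltB).
Qed.

Lemma val_Zq_nat k m : (m < 3 * k + 2)%N -> (m%:R : 'Z_(3 * k + 2)) = m :> nat.
Proof. by move=> ltm; rewrite val_Zp_nat ?modn_small //; lia. Qed.

(** If [b] is less than [k + 1], then [b + b] is in the interval; if it is
    greater, some sum of two elements wraps around to [b]. *)
Lemma sum_free_interval k (b : 'Z_(3 * k + 2)) :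
  sum_free [set b + (val i)%:R | i in 'I_k.+1] ->
  [set b + (val i)%:R | i in 'I_k.+1] = middle_residues (3 * k + 2) k.
Proof.
set B := imset _ _ => Bsf.
have memB j : (j < k.+1)%N -> b + j%:R \in B.
  by move=> ltj; apply/imsetP; exists (Ordinal ltj).
have q0 : (3 * k + 2)%:R = 0 :> 'Z_(3 * k + 2) by rewrite pchar_Zp //; lia.
have ltb : (b < 3 * k + 2)%N.
  by have := ltn_ord b; rewrite [X in (_ < X)%N -> _]Zp_cast //; lia.
have eb : b = k.+1 :> nat.
  have [leb|ltkb] := leqP b k.
    case: (Bsf (b + 0%:R) (b + 0%:R) (b + (b : nat)%:R)); rewrite ?memB //.
    by rewrite !addr0 natr_Zp.
  have [ltkb2|] := ltnP k.+1 b; last by lia.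
  pose s := (3 * k + 2 - b)%N.
  pose i := minn k s; pose j := (s - i)%N.
  case: (Bsf (b + i%:R) (b + j%:R) (b + 0%:R)); rewrite ?memB //; try lia.
  rewrite addrACA -natrD -addrA addr0 -[X in _ + (X + _)](natr_Zp b) -natrD.
  have -> : (b + (i + j) = 3 * k + 2)%N by lia.
  by rewrite q0 addr0.
apply/setP => x; rewrite [in RHS]inE; apply/imsetP/idP => [[[m ltm] _ ->]|/andP[le1 le2]].
  have -> : b + (val (Ordinal ltm))%:R = (k.+1 + m)%:R.
    by rewrite natrD; congr (_ + _); rewrite -eb natr_Zp.
  by rewrite val_Zq_nat; lia.
have ltx : (val x - k.+1 < k.+1)%N by move: le1 le2; rewrite /=; lia.
have ex : x = b + (val x - k.+1)%:R.
  rewrite -{1}(natr_Zp b) -natrD -{1}(natr_Zp x); congr _%:R.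
  by move: le1; rewrite eb /=; lia.
by exists (Ordinal ltx).
Qed.

(** Division by the difference of the progression [B] turns it into an interval;
    if [k = 0], any difference will do. *)
Lemma sum_free_middle k (B : {set 'Z_(3 * k + 2)}) : prime (3 * k + 2) ->
    sum_free B -> #|B| = k.+1 ->
  exists2 u : 'Z_(3 * k + 2), u \is a GRing.unit
    & forall x, (x \in B) = (u * x \in middle_residues (3 * k + 2) k).
Proof.
move=> prq Bsf cB.
have cZ : #|'Z_(3 * k + 2)| = (3 * k + 2)%N by rewrite card_ord Zp_cast ?prime_gt1.
have unitZ (d : 'Z_(3 * k + 2)) : d != 0 -> d \is a GRing.unit.
  move=> dn0; rewrite -(natr_Zp d) unitZpE ?prime_gt1 // prime_coprime //.
  rewrite gtnNdvd // ?lt0n //.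
  by have := ltn_ord d; rewrite [X in (_ < X)%N -> _]Zp_cast ?prime_gt1.
have [d ud dB] : exists2 d : 'Z_(3 * k + 2), d \is a GRing.unit
    & (#|B| <= #|B :&: shift d B| + 1)%N.
  have [k0|k_gt0] := posnP k.
    exists 1; rewrite ?unitr1 // cB.
    by apply: (@leq_trans 1); rewrite ?addn1 // ltnS k0.
  have [|||d dn0 dB] := @sum_free_progression 'Z_(3 * k + 2) _ B Bsf; rewrite ?cZ ?cB //; try lia.
  by exists d; rewrite ?unitZ // -cB.
pose B' := [set x | d * x \in B].
have injd : injective ( *%R d) := mulrI ud.
have card_dil (S : {set 'Z_(3 * k + 2)}) : #|[set x | d * x \in S]| = #|S|.
  rewrite -(card_imset _ injd); congr #|pred_of_set _|; apply/setP => x.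
  apply/imsetP/idP => [[y + ->]|Sx]; first by rewrite inE.
  by exists (d^-1 * x); rewrite ?inE mulVKr.
have B'sf : sum_free B'.
  move=> x y z; rewrite !inE => Bx By Bz xyz.
  by apply: (Bsf _ _ _ Bx By Bz); rewrite -mulrDr xyz.
have cB' : #|B'| = k.+1 by rewrite card_dil.
have progB' : (#|B'| <= #|B' :&: shift (1%R : 'Z_(3 * k + 2)) B'| + 1)%N.
  rewrite card_dil (leq_trans dB) // leq_add2r -(card_dil (B :&: _)) subset_leq_card //.
  by apply/subsetP => x; rewrite !inE !mem_shift !inE mulrBr mulr1.
have [||b eB'] := interval_of_progression _ _ progB'.
- by rewrite -card_gt0 cB'.
- apply: contra_eq_neq cB' => ->; rewrite cardsT cZ; lia.
move: eB'; rewrite cB' => eB'; exists d^-1; rewrite ?unitrV // => x.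
have midB' : B' = middle_residues (3 * k + 2) k.
  by rewrite [LHS]eB' sum_free_interval // -eB'.
by rewrite -midB' inE mulVKr.
Qed.

End Residues.

(** * Homomorphisms onto residues *)

Section Quotient.
Variable G : finZmodType.
Implicit Types (A H : {set G}).

Lemma exists_additive (V : zmodType) (f : G -> V) : {morph f : x y / x + y} ->
  exists phi : {additive G -> V}, phi =1 f.
Proof.
move=> fD.
have fB : zmod_morphism f.
  by move=> x y; apply/(canRL (addrK (f y))); rewrite -fD subrK.
by exists (HB.pack_for {additive G -> V} f (GRing.isZmodMorphism.Build G V f fB)).
Qed.

(** The coset of [d] has order [q] in the quotient group, which has [q]
    elements. *)
Lemma mulrn_mem_subgroup H q d m : prime q -> zmod_closed H ->
  (#|G| = q * #|H|)%N -> d \notin H -> (d *+ m \in H) = (q %| m)%N.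
Proof.
move=> prq Hs cG nHd; have [H0 _] := Hs.
have gsH : group_set H.
  apply/group_setP; split=> [|x y Hx Hy]; first exact: H0.
  exact: (zmod_closedD Hs Hx Hy).
pose K := Group gsH.
have nK x : x \in 'N(K)%g.
  have := sub_abelian_norm (FinRing.zmod_abelian [set: G]) (subsetT K).
  by move/subsetP; apply; rewrite inE.
have memK x : (x \in H) = (coset K x == 1%g).
  apply/idP/eqP => [Kx|/(coset_idr (nK x)) //]; exact: coset_id.
have cGK : #|([set: G] / K)%g| = q.
  rewrite card_quotient; last by apply/subsetP => x _.
  have hgt0 : (0 < #|H|)%N by apply/card_gt0P; exists 0.
  apply/eqP; rewrite -(eqn_pmul2l hgt0) (mulnC _ q) -cG -card_setT.
  exact/eqP/(Lagrange (subsetT K)).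
have : (#[coset K d]%g %| q)%N.
  by rewrite -cGK; apply: cardSg; rewrite cycle_subG mem_quotient ?inE.
have [_ /(_ _)/[apply]/orP[]] := primeP prq.
  by rewrite order_eq1 -memK (negbTE nHd).
move=> /eqP eq; rewrite memK -[in RHS]eq -[d *+ m]/(d ^+ m)%g morphX //.
by rewrite -order_dvdn.
Qed.

(** Every [x] lies in the coset of [d *+ u] for exactly one residue [u], where
    [d] is any element outside [H]; this [u] is the value at [x]. *)
Lemma exists_hom_Zq H q : prime q -> zmod_closed H -> (#|G| = q * #|H|)%N ->
  exists phi : {additive G -> 'Z_q},
    (forall u, exists x, phi x = u) /\ (forall x, (phi x == 0) = (x \in H)).
Proof.
move=> prq Hs cG; have [H0 HB] := Hs; have q_gt1 := prime_gt1 prq.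
have hgt0 : (0 < #|H|)%N by apply/card_gt0P; exists 0.
have [d nHd] : exists d, d \notin H.
  apply/existsP; rewrite -negb_forall; apply: contraL q_gt1 => /forallP HT.
  rewrite -leqNgt -(leq_pmul2r hgt0) mul1n -cG -card_setT.
  by apply/subset_leq_card/subsetP => x _.
have memd m := mulrn_mem_subgroup m prq Hs cG nHd.
have uniq a b : d *+ a - d *+ b \in H -> a%:R = b%:R :> 'Z_q.
  wlog leba : a b / (b <= a)%N => [W Hab|].
    have [/W->//|/ltnW/W<-//] := leqP b a.
    by rewrite -opprB -sub0r HB.
  rewrite -mulrnBr // memd => /dvdnP[c ec].
  by rewrite -(subnK leba) ec natrD natrM pchar_Zp // mulr0 add0r.
have ltq (u : 'Z_q) : (u < q)%N by rewrite -[X in (_ < X)%N](Zp_cast q_gt1) ltn_ord.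
have surj x : exists u : 'Z_q, x - d *+ u \in H.
  pose f (w : 'Z_q * G) := d *+ w.1 + w.2.
  have injf : {in setX setT H &, injective f}.
    move=> [u h] [v h'] /setXP[_ /= Hh] /setXP[_ /= Hh'] /= e.
    suff uv : u = v by move: e; rewrite /f /= uv => /addrI ->.
    rewrite -(natr_Zp u) -(natr_Zp v); apply: uniq.
    have -> : d *+ u - d *+ v = h' - h; last exact: HB.
    by apply/eqP; rewrite subr_eq addrAC eq_sym subr_eq addrC eq_sym; apply/eqP.
  have : x \in f @: setX setT H.
    suff -> : f @: setX setT H = setT by rewrite inE.
    apply/eqP; rewrite eqEcard subsetT card_in_imset // cardsX !cardsT.
    by rewrite card_ord (Zp_cast q_gt1); apply: eq_leq cG.
  case/imsetP => -[u h] /setXP[_ /= Hh] ->; exists u.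
  by rewrite /f /= [d *+ u + h]addrC addrK.
pose f x := xchoose (surj x).
have fH x : x - d *+ f x \in H := xchooseP (surj x).
have f_uniq x u : x - d *+ (u : 'Z_q) \in H -> f x = u.
  move=> Hxu; rewrite -(natr_Zp u) -(natr_Zp (f x)); apply: uniq.
  by rewrite -[_ - _](subrKA x) addrC [x - _ + _]addrC -[d *+ f x - x]opprB addrC HB.
have [|phi ephi] := @exists_additive 'Z_q f.
  move=> x y; apply: f_uniq.
  have Hxy : x + y - d *+ (f x + f y)%N \in H.
    by rewrite mulrnDr opprD addrACA zmod_closedD.
  rewrite -[_ - _](subrKA (d *+ (f x + f y)%N)) zmod_closedD //.
  rewrite /= {1}(divn_eq (f x + f y) (Zp_trunc q).+2) mulrnDr addrK memd.
  by rewrite dvdn_mull // Zp_cast.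
exists phi; split=> [u|x]; first by exists (d *+ u); rewrite ephi; apply: f_uniq; rewrite subrr.
rewrite ephi; apply/eqP/idP => [fx0|Hx]; first by have := fH x; rewrite fx0 subr0.
by apply: f_uniq; rewrite subr0.
Qed.

End Quotient.

(** * Large sum-free sets in groups of type I *)

Lemma card_preim_additive (G V : finZmodType) (phi : {additive G -> V}) (S : {set V}) :
  (forall v, exists x, phi x = v) ->
  #|phi @^-1: S| = (#|S| * #|phi @^-1: [set 0%R]|)%N.
Proof.
move=> surj; rewrite -sum1_card (partition_big phi (mem S)) /=; last first.
  by move=> x; rewrite inE.
rewrite -sum_nat_const; apply: eq_bigr => v Sv.
have [y yv] := surj v; rewrite -(card_shift y (phi @^-1: [set 0])) -sum1_card.
apply: eq_bigl => x; rewrite mem_shift !inE raddfB yv subr_eq0.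
by case: eqP => [->|]; rewrite ?Sv ?andbF.
Qed.

(** A product of numbers that are [0] or [1] modulo [3] is not [2] modulo [3]. *)
Lemma prime_factor_2mod3 N : (N %% 3 = 2)%N ->
  exists r, [/\ prime r, (r %| N)%N & (r %% 3 = 2)%N].
Proof.
have [m] := ubnP N; elim: m N => // m IHm N ltNm N2.
have N_gt1 : (1 < N)%N by case: N N2 {ltNm} => [|[|]].
have pr := pdiv_prime N_gt1; have [r2|r2] := eqVneq (pdiv N %% 3)%N 2%N.
  by exists (pdiv N); rewrite pdiv_dvd.
have /dvdnP[c ec] := pdiv_dvd N; have r_gt1 := prime_gt1 pr.
have c_gt0 : (0 < c)%N by case: c ec => // ec; move: N_gt1; rewrite ec.
have [||r [prr rc r2']] := IHm c.
- rewrite -ltnS; apply: leq_trans ltNm; rewrite ltnS ec.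
  by rewrite ltn_Pmulr.
- move: N2; rewrite ec -modnMm; have := ltn_pmod (pdiv N) (isT : 0 < 3)%N.
  have := ltn_pmod c (isT : 0 < 3)%N; move: r2.
  by move: (c %% 3)%N (pdiv N %% 3)%N => [|[|[|?]]] [|[|[|?]]].
by exists r; rewrite ec dvdn_mulr.
Qed.

(** The order of the quotient by the subgroup that [sum_free_hull] provides is
    [2] modulo [3] and less than [2 * p], hence is a prime factor of [#|G|], and
    the image of [A] is one of the sets described by [sum_free_middle].  The
    bound on [#|A|] says that [3 * #|A| - #|G|], which is at most the order of
    the subgroup, exceeds [#|G| / (2 * p)]. *)
Lemma sum_free_typeI p (G : finZmodType) (A : {set G}) :
    typeI p G -> sum_free A -> (#|G| + 2 * p * #|G| < 6 * p * #|A|)%N ->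
  exists k (phi : {additive G -> 'Z_(3 * k + 2)}),
    [/\ prime (3 * k + 2), (p <= 3 * k + 2)%N, forall u, exists x, phi x = u
      & A \subset phi @^-1: middle_residues (3 * k + 2) k].
Proof.
move=> [prp p2 pG minp] Asf ltA.
have [|H [Hs AHsf cAH]] := sum_free_hull Asf.
  by rewrite -(ltn_pmul2l (_ : 0 < 2 * p)%N) ?muln_gt0 ?prime_gt0 //; nia.
have leA := subset_leq_card (subset_hull A Hs); have [H0 HB] := Hs.
have hgt0 : (0 < #|H|)%N by apply/card_gt0P; exists 0.
have /dvdnP[N eN] := card_subgroup_dvd Hs.
have AHper x h : x \in sumset A H -> h \in H -> x + h \in sumset A H.
  by move=> /sumsetP[y [h' [Ay Hh' ->]]] Hh; rewrite -addrA mem_sumset ?zmod_closedD.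
have /dvdnP[a ea] : (#|H| %| #|sumset A H|)%N by apply: card_periodic_dvd.
have eaN : (3 * a = N.+1)%N.
  by apply/eqP; rewrite -(eqn_pmul2r hgt0) -mulnA -ea cAH mulSn -eN addnC.
have [r [prr /dvdnP[c ec] r2]] : exists r, [/\ prime r, (r %| N)%N & (r %% 3 = 2)%N].
  by apply: prime_factor_2mod3; lia.
have lepr : (p <= r)%N.
  by apply: minp; rewrite ?r2 // eN ec dvdn_mulr // dvdn_mull.
have ltN : (N < 2 * p)%N.
  rewrite -(ltn_pmul2r hgt0) -eN.
  have : (3 * #|A| <= #|G| + #|H|)%N by rewrite -cAH leq_mul2l leA.
  by move: ltA; move: #|A| #|G| #|H| => *; nia.
have eNr : N = r.
  move: ec lepr ltN eaN; clear; case: c => [|[|c]] ec; rewrite ec ?mul1n //; first by lia.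
  by have : (2 * r <= c.+2 * r)%N by [rewrite leq_mul2r orbT]; lia.
have [k ek] : exists k, a = k.+1 by exists a.-1; rewrite prednK //; lia.
have eN' : N = (3 * k + 2)%N by lia.
subst a; rewrite -eNr {}eN' in eN prr lepr *.
have [phi0 [surj0 ker0]] := exists_hom_Zq prr Hs eN.
pose B := phi0 @: sumset A H.
have memB x : (phi0 x \in B) = (x \in sumset A H).
  apply/imsetP/idP => [[y AHy /eqP]|AHx]; last by exists x.
  by rewrite -subr_eq0 -raddfB ker0 => Hxy; rewrite -(subrK y x) addrC AHper.
have preB : phi0 @^-1: B = sumset A H by apply/setP=> x; rewrite inE memB.
have kerH : phi0 @^-1: [set 0] = H by apply/setP=> x; rewrite !inE ker0.
have cB : #|B| = k.+1.
  apply/eqP; rewrite -(eqn_pmul2r hgt0) -ea -preB.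
  by rewrite card_preim_additive // kerH.
have Bsf : sum_free B.
  move=> u v w; have [x <-] := surj0 u; have [y <-] := surj0 v.
  have [z <-] := surj0 w; rewrite !memB => AHx AHy AHz; rewrite -raddfD => exyz.
  by apply: (AHsf _ _ _ AHx AHy (_ : x + y \in _)); rewrite // -memB exyz memB.
have [u uu Bmid] := sum_free_middle prr Bsf cB.
have [|phi ephi] := @exists_additive G 'Z_(3 * k + 2) (fun x => u * phi0 x).
  by move=> x y; rewrite raddfD mulrDr.
exists k, phi; split=> // [v|].
  by have [x ex] := surj0 (u^-1 * v); exists x; rewrite ephi ex mulVKr.
apply/subsetP => x Ax; rewrite inE ephi -Bmid memB.
exact: (subsetP (subset_hull A Hs)).
Qed.

(** * Middle residues *)

Section MiddleResidues.
Variable k : nat.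
Local Notation q := (3 * k + 2)%N.
Local Notation mid := (middle_residues q k).
Implicit Types (u v : 'Z_q).

Lemma Zq_ltn u : (u < q)%N.
Proof. by have := ltn_ord u; rewrite [X in (_ < X)%N -> _]Zp_cast //; lia. Qed.

Lemma val_Zq_add u v :
  (u + v)%R = (if u + v < q then u + v else u + v - q)%N :> nat.
Proof.
have q_gt1 : (1 < q)%N by lia.
have := Zq_ltn u; have := Zq_ltn v.
rewrite [LHS]/= [X in (_ %% X)%N](Zp_cast q_gt1); move: (nat_of_ord u) (nat_of_ord v).
move=> a b ltb lta; case: ltnP => [ltq|leq]; first by rewrite modn_small.
by rewrite -{1}(subnK leq) modnDr modn_small; lia.
Qed.

Lemma val_Zq_opp u : (- u)%R = (if (u : nat) == 0 then 0 else q - u)%N :> nat.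
Proof.
have q_gt1 : (1 < q)%N by lia.
have := Zq_ltn u; rewrite [LHS]/= [X in (_ %% X)%N](Zp_cast q_gt1).
rewrite [X in (X - _)%N](Zp_cast q_gt1); move: (nat_of_ord u) => a lta.
case: eqP => [->|an0]; first by rewrite subn0 modnn.
by rewrite modn_small; lia.
Qed.

Lemma mem_mid u : (u \in mid) = (k < u <= 2 * k + 1)%N.
Proof. by rewrite inE addn1. Qed.

Lemma mid0 : 0 \notin mid.
Proof. by rewrite mem_mid. Qed.

Lemma mid_k : k%:R \notin mid.
Proof. by rewrite mem_mid val_Zq_nat; lia. Qed.

Lemma oppr_mid u : (- u \in mid) = (u \in mid).
Proof. by rewrite !mem_mid val_Zq_opp; have := Zq_ltn u; case: eqP; lia. Qed.

Lemma mid_sum_free : sum_free mid.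
Proof.
move=> u v w; rewrite !mem_mid => Hu Hv + e; rewrite -e val_Zq_add.
by have := Zq_ltn u; have := Zq_ltn v; case: ifP; lia.
Qed.

Lemma mid_kk : (0 < k)%N -> k%:R + k%:R \in mid.
Proof. by move=> k_gt0; rewrite -natrD mem_mid val_Zq_nat; lia. Qed.

Lemma card_mid : #|mid| = k.+1.
Proof.
have -> : mid = [set (k.+1 + val i)%:R | i in 'I_k.+1].
  apply/setP=> u; rewrite mem_mid; apply/idP/imsetP => [/andP[lek leu]|[[m ltm] _ ->]].
    have ltu : (u - k.+1 < k.+1)%N by lia.
    exists (Ordinal ltu) => //.
    by rewrite -{1}(natr_Zp u); congr _%:R; rewrite subnKC.
  by rewrite [val _]/= val_Zq_nat; lia.
rewrite card_imset ?card_ord // => i j /(congr1 (@nat_of_ord _)).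
have := ltn_ord i; have := ltn_ord j; rewrite !val_Zq_nat.
- by move=> _ _ /addnI /val_inj.
- by move: (ltn_ord j) => /=; lia.
by move: (ltn_ord i) => /=; lia.
Qed.

Definition mid_count u := #|[set v in mid | u + v \in mid]|.

Lemma mid_count_k : mid_count k%:R = 1%N.
Proof.
rewrite /mid_count -[RHS](cards1 (k.+1%:R : 'Z_q)); congr #|pred_of_set _|.
apply/setP=> v; rewrite inE in_set1 !mem_mid val_Zq_add val_Zq_nat; last by lia.
apply/idP/eqP => [|->]; last by rewrite val_Zq_nat; [case: ifP|]; lia.
move=> Hv; rewrite -(natr_Zp v); congr _%:R.
by move: Hv; have := Zq_ltn v; case: ifP; lia.
Qed.

Lemma mid_count_ge1 u : u \notin mid -> (0 < mid_count u)%N.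
Proof.
rewrite mem_mid => nu; have ltu := Zq_ltn u; apply/card_gt0P.
have [lek|ltk] := leqP u k.
  exists (k.+1%:R); rewrite inE !mem_mid val_Zq_add val_Zq_nat; last by lia.
  by case: ifP; lia.
exists ((2 * k + 1)%:R); rewrite inE !mem_mid val_Zq_add val_Zq_nat; last by lia.
by case: ifP; lia.
Qed.

(** Adding a class [u] below [k] to the two lowest middle classes, or one above
    [- k] to the two highest, gives middle classes again. *)
Lemma mid_count_ge2 u : u \notin mid -> u != k%:R -> u != - k%:R ->
  (1 < mid_count u)%N.
Proof.
rewrite mem_mid => nu uk uNk; have ltu := Zq_ltn u; apply/card_gt1P.
have {}uk : (u : nat) != k.
  by apply: contraNneq uk => e; rewrite -(natr_Zp u) e.
have {}uNk : (u : nat) != (2 * k + 2)%N.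
  apply: contraNneq uNk => e; rewrite -(natr_Zp u) e eq_sym -subr_eq0 -opprD oppr_eq0 -natrD.
  have -> : (k + (2 * k + 2) = q)%N by lia.
  by rewrite pchar_Zp //; lia.
pose s (a : nat) := (if u + a < q then u + a else u + a - q)%N.
have two (a b : nat) : (k < a < b)%N -> (b <= 2 * k + 1)%N ->
    (k < s a <= 2 * k + 1)%N -> (k < s b <= 2 * k + 1)%N ->
    exists x y, [/\ x \in [set v in mid | u + v \in mid],
                    y \in [set v in mid | u + v \in mid] & x != y].
  move=> ltab leb ua ub; exists (a%:R), (b%:R).
  have ea : (a%:R : 'Z_q) = a :> nat by apply: val_Zq_nat; lia.
  have eb : (b%:R : 'Z_q) = b :> nat by apply: val_Zq_nat; lia.
  split; first by rewrite in_set !mem_mid val_Zq_add ea ua andbT; lia.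
    by rewrite in_set !mem_mid val_Zq_add eb ub andbT; lia.
  by apply/eqP => /(congr1 (@nat_of_ord _)); rewrite ea eb; lia.
have [ltk|lek] := ltnP u k; first by apply: (two k.+1 k.+2); rewrite /s; try case: ifP; lia.
by apply: (two (2 * k)%N (2 * k + 1)%N); rewrite /s; try case: ifP; lia.
Qed.

End MiddleResidues.

(** * Counting triples *)

Definition triples (G : finZmodType) (X Y Z : {set G}) : nat :=
  \sum_(x in X) #|[set y in Y | (x + y)%R \in Z]|.

Section Triples.
Variable G : finZmodType.
Implicit Types (X Y Z A B M : {set G}).

Lemma triplesE X Y Z :
  triples X Y Z = #|[set w : G * G | [&& w.1 \in X, w.2 \in Y & w.1 + w.2 \in Z]]|.
Proof.
rewrite -sum1_card /triples.
under eq_bigr do rewrite -sum1_card.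
rewrite pair_big_dep /=; apply: eq_bigl => -[x y] /=.
by rewrite !inE.
Qed.

Lemma ST_triples A : ST A = triples A A A.
Proof.
rewrite triplesE /ST.
have inj : injective (fun w : G * G => (w.1, w.2, w.1 + w.2)).
  by move=> [x y] [x' y'] /= [-> ->].
rewrite -(card_imset _ inj); congr #|pred_of_set _|; apply/setP => -[[x y] z].
rewrite inE /=; apply/and4P/imsetP => [[Ax Ay Az /eqP e]|[[x' y']]].
  by exists (x, y); rewrite ?inE /= ?e ?Ax ?Ay.
by rewrite inE /= => /and3P[Ax Ay Az] [-> -> ->]; split.
Qed.

Lemma triplesC X Y Z : triples X Y Z = triples Y X Z.
Proof.
rewrite !triplesE.
have inj : injective (fun w : G * G => (w.2, w.1)) by move=> [x y] [x' y'] [-> ->].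
rewrite -(card_imset _ inj).
congr #|pred_of_set _|; apply/setP => -[x y]; apply/imsetP/idP => [[[x' y']]|].
  by rewrite !inE /= => /and3P[Xx Yy Zxy] [-> ->]; rewrite Xx Yy addrC.
by rewrite !inE /= => /and3P[Yx Xy Zxy]; exists (y, x); rewrite ?inE //= Yx Xy addrC.
Qed.

(** The triple [x + y = z] is also the triple [z + (- x) = y]. *)
Lemma triples_opp X Y Z : triples X Y Z = triples Z (oppset X) Y.
Proof.
rewrite !triplesE.
have inj : injective (fun w : G * G => (w.1 + w.2, - w.1)).
  by move=> [x y] [x' y'] /= [e /oppr_inj xx]; move: e; rewrite xx => /addrI ->.
rewrite -(card_imset _ inj); congr #|pred_of_set _|; apply/setP => -[z x].
apply/imsetP/idP => [[[x' y']]|].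
  rewrite !inE /= mem_oppset => /and3P[Xx Yy Zxy] [-> ->].
  by rewrite opprK Xx Zxy /= addrC addKr.
rewrite !inE /= mem_oppset => /and3P[Zz Xx Yzx].
by exists (- x, z + x); rewrite ?inE /= ?opprK ?[z + x]addrC ?addKr // Xx addrC Yzx.
Qed.

Lemma triplesUl X X' Y Z : [disjoint X & X'] ->
  triples (X :|: X') Y Z = (triples X Y Z + triples X' Y Z)%N.
Proof.
move=> dXX; rewrite /triples -bigU //=; apply: eq_bigl => x; by rewrite !inE.
Qed.

Lemma triplesUm X Y Y' Z : [disjoint Y & Y'] ->
  triples X (Y :|: Y') Z = (triples X Y Z + triples X Y' Z)%N.
Proof. by move=> dYY; rewrite triplesC triplesUl // ![triples _ X _]triplesC. Qed.

Lemma triplesUr X Y Z Z' : [disjoint Z & Z'] ->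
  triples X Y (Z :|: Z') = (triples X Y Z + triples X Y Z')%N.
Proof.
by move=> dZZ; rewrite triples_opp triplesUl // -!(triples_opp X Y).
Qed.

Lemma triples_sub X X' Y Y' Z Z' : X \subset X' -> Y \subset Y' -> Z \subset Z' ->
  (triples X Y Z <= triples X' Y' Z')%N.
Proof.
move=> /subsetP sX /subsetP sY /subsetP sZ; rewrite !triplesE.
apply/subset_leq_card/subsetP => w; rewrite !inE => /and3P[Xw Yw Zw].
by rewrite sX ?sY ?sZ.
Qed.

Lemma triples_le_lm X Y Z : (triples X Y Z <= #|X| * #|Y|)%N.
Proof.
rewrite -sum_nat_const; apply: leq_sum => x _; apply: subset_leq_card.
by apply/subsetP => y; rewrite inE => /andP[].
Qed.

Lemma triples_le_lr X Y Z : (triples X Y Z <= #|X| * #|Z|)%N.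
Proof. by rewrite mulnC triples_opp -(card_oppset X) triples_le_lm. Qed.

Lemma triples_const X Y Z c :
  {in X, forall x, #|[set y in Y | x + y \in Z]| = c} ->
  triples X Y Z = (#|X| * c)%N.
Proof. by move=> XYZ; rewrite -sum_nat_const; apply: eq_bigr. Qed.

Lemma triples_ge X Y Z c :
  {in X, forall x, c <= #|[set y in Y | (x + y)%R \in Z]|}%N ->
  (#|X| * c <= triples X Y Z)%N.
Proof. by move=> XYZ; rewrite -sum_nat_const; apply: leq_sum. Qed.

Lemma triples_full X Y Z : {in X & Y, forall x y, x + y \in Z} ->
  triples X Y Z = (#|X| * #|Y|)%N.
Proof.
move=> XYZ; apply: triples_const => x Xx; congr #|pred_of_set _|.
by apply/setP => y; rewrite inE; case Yy: (y \in Y); rewrite // XYZ.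
Qed.

Lemma triples_full_r X Y Z : {in X & Z, forall x z, z - x \in Y} ->
  triples X Y Z = (#|X| * #|Z|)%N.
Proof.
move=> XZY; rewrite triples_opp -(card_oppset X) mulnC; apply: triples_full => z x Zz.
by rewrite mem_oppset => Xx; rewrite -[x]opprK XZY.
Qed.

Lemma triples_empty X Y Z : {in X & Y, forall x y, x + y \notin Z} ->
  triples X Y Z = 0%N.
Proof.
move=> XYZ; rewrite (@triples_const X Y Z 0) ?muln0 // => x Xx.
by apply/eqP; rewrite cards_eq0; apply/eqP/setP => y; rewrite !inE;
  case Yy: (y \in Y); rewrite // (negbTE (XYZ _ _ Xx Yy)).
Qed.

Lemma sum_free_triples X : triples X X X = 0%N -> sum_free X.
Proof.
move=> /eqP; rewrite triplesE cards_eq0 => /eqP X0 x y z Xx Xy Xz e.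
by have := in_set0 (x, y); rewrite -X0 inE /= Xx Xy e Xz.
Qed.

Lemma triplesUU B X : [disjoint B & X] ->
  triples (B :|: X) (B :|: X) (B :|: X) =
    (triples B B B + (triples X B B + triples B X B + triples B B X)
     + (triples X X B + triples X B X + triples B X X) + triples X X X)%N.
Proof.
move=> dBX; rewrite triplesUl // !triplesUm // !triplesUr //.
by rewrite /=; lia.
Qed.

(** Removing [Y] from [M] destroys at most [#|X| * #|Y|] triples for each place
    that an element of [Y] can take next to an element of [X]. *)
Lemma triples_deletion B X Y : [disjoint B & Y] ->
  let M := B :|: Y in
  [/\ (triples X M M <= triples X B B + 2 * (#|X| * #|Y|))%N,
      (triples M M X <= triples B B X + 2 * (#|X| * #|Y|))%N,
      (triples X X M <= triples X X B + #|X| * #|Y|)%N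
    & (triples X M X <= triples X B X + #|X| * #|Y|)%N].
Proof.
move=> dBY M; split.
- have -> : triples X M M = (triples X B B + triples X B Y + triples X Y M)%N.
    by rewrite [LHS]triplesUm // (triplesUr X B).
  have := triples_le_lr X B Y; have := triples_le_lm X Y M; lia.
- have -> : triples M M X = (triples B B X + triples B Y X + triples Y M X)%N.
    by rewrite [LHS]triplesUl // (triplesUm B).
  have := triples_le_lr Y B X; rewrite triplesC; have := triples_le_lr Y M X; lia.
- by rewrite triplesUr // leq_add2l triples_le_lr.
- by rewrite triplesUm // leq_add2l triples_le_lm.
Qed.

(** Only triples with an element in [M :\: A] are lost on passing from [M] to
    [A].  A triple with one element in [A :\: M] has two places for it, one with
    two such elements has one, and there are three patterns of either kind: this
    is the factor [9]. *)
Lemma triples_exchange A M :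
  (2 * triples (A :\: M) M M + triples M M (A :\: M)
     + triples (A :\: M) (A :\: M) M + 2 * triples (A :\: M) M (A :\: M)
     + triples (A :\: M) (A :\: M) (A :\: M)
   <= triples A A A + 9 * (#|A :\: M| * #|M :\: A|))%N.
Proof.
set X := A :\: M; set Y := M :\: A; pose B := A :&: M.
have dBX : [disjoint B & X].
  rewrite -setI_eq0; apply/eqP/setP => x; rewrite in_set0 in_setI in_setI in_setD.
  by case: (x \in M); rewrite ?andbF.
have dBY : [disjoint B & Y].
  rewrite -setI_eq0; apply/eqP/setP => x; rewrite in_set0 in_setI in_setI in_setD.
  by case: (x \in A); rewrite ?andbF.
have defA : A = B :|: X by rewrite setID.
have defM : M = B :|: Y by rewrite /B setIC setID.
have [] := triples_deletion X dBY; rewrite /= -defM.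
have eA := triplesUU dBX; rewrite -defA in eA; rewrite eA.
rewrite (triplesC B X B) (triplesC B X X); lia.
Qed.

End Triples.

(** * Schur triples and middle sets *)

Section MiddleSets.
Variables (k : nat) (G : finZmodType) (phi : {additive G -> 'Z_(3 * k + 2)}).
Hypothesis surj : forall u, exists x, phi x = u.
Local Notation mid := (middle_residues (3 * k + 2) k).
Local Notation M := (phi @^-1: mid).
Local Notation K := #|phi @^-1: [set 0%R]|.
Implicit Types (A X : {set G}).

Lemma card_fibre_mul : #|G| = ((3 * k + 2) * K)%N.
Proof.
rewrite -card_setT -(_ : phi @^-1: setT = setT); last by apply/setP=> x; rewrite !inE.
by rewrite card_preim_additive // cardsT card_ord Zp_cast //; lia.
Qed.

Lemma card_middle_set : #|M| = (k.+1 * K)%N.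
Proof. by rewrite card_preim_additive // card_mid. Qed.

Lemma mem_middle_set x : (x \in M) = (phi x \in mid).
Proof. by rewrite in_set. Qed.

Lemma oppset_middle_set : oppset M = M.
Proof. by apply/setP=> x; rewrite mem_oppset !mem_middle_set raddfN oppr_mid. Qed.

Lemma triples_middle_set : triples M M M = 0%N.
Proof.
apply: triples_empty => x y; rewrite !mem_middle_set => Mx My.
by apply/negP; rewrite raddfD => Mxy; apply: (mid_sum_free Mx My Mxy).
Qed.

Lemma card_middle_pairs x : #|[set y in M | x + y \in M]| = (mid_count (phi x) * K)%N.
Proof.
rewrite /mid_count -card_preim_additive //; congr #|pred_of_set _|.
by apply/setP=> y; rewrite [LHS]in_set !mem_middle_set raddfD [RHS]in_set [RHS]in_set.
Qed.

(** With exactly one element in [A']: in each of the three positions, the class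
    [k] forms exactly one triple with two middle classes.  With two elements in
    [A']: their difference has the class [0], which is not a middle class, and
    their sum has the class [k + k], which is one unless [k = 0]. *)
Lemma ST_middle_union A' : A' \subset phi @^-1: [set k%:R] -> sum_free A' ->
  ST (M :|: A') = (3 * (#|A'| * K) + (0 < k) * (#|A'| * #|A'|))%N.
Proof.
move=> /subsetP sA' A'sf.
have phiA' x : x \in A' -> phi x = k%:R by move=> /sA'; rewrite !inE => /eqP.
have dMA : [disjoint M & A'].
  rewrite -setI_eq0; apply/eqP/setP => x; rewrite !in_set0 in_setI mem_middle_set.
  by apply/negP => /andP[Mx /phiA' ex]; move: (mid_k k); rewrite -ex Mx.
have single : triples A' M M = (#|A'| * K)%N.
  apply: triples_const => x /phiA' ex.
  by rewrite card_middle_pairs ex mid_count_k mul1n.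
have A'MA' : triples A' M A' = 0%N.
  apply: triples_empty => x y /phiA' ex; rewrite mem_middle_set => My.
  apply/negP => /phiA'; rewrite raddfD ex => /(canRL (addKr _)).
  by rewrite addNr => ey; move: (mid0 k); rewrite -ey My.
have A'A'M : triples A' A' M = ((0 < k) * (#|A'| * #|A'|))%N.
  have [k_gt0|] := ltnP 0 k.
    rewrite mul1n; apply: triples_full => x y /phiA' ex /phiA' ey.
    by rewrite mem_middle_set raddfD ex ey mid_kk.
  rewrite leqn0 => /eqP k0; apply: triples_empty => x y /phiA' ex /phiA' ey.
  have kR0 : k%:R = 0 :> 'Z_(3 * k + 2) := congr1 (fun n => n%:R) k0.
  by rewrite mem_middle_set raddfD ex ey kR0 addr0 mid0.
have MMA' : triples M M A' = triples A' M M.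
  by rewrite triples_opp oppset_middle_set.
rewrite ST_triples triplesUU // triples_middle_set MMA' ![triples M A' _]triplesC.
rewrite single A'MA' A'A'M [triples A' A' A']triples_empty; first by lia.
by move=> x y Ax Ay; apply/negP => Axy; apply: (A'sf _ _ _ Ax Ay Axy).
Qed.

Section LowerBound.
Variable A : {set G}.
Local Notation X := (A :\: M).
Local Notation Y := (M :\: A).
Local Notation U := (X :&: phi @^-1: [set k%:R]).
Local Notation V := (X :&: phi @^-1: [set - k%:R]).
Local Notation W := (X :\: (phi @^-1: [set k%:R] :|: phi @^-1: [set - k%:R])).

Lemma disjointUV : (0 < k)%N -> [disjoint U & V].
Proof.
move=> k_gt0; rewrite -setI_eq0; apply/eqP/setP => x; rewrite in_set0.
apply/negP => /setIP[/setIP[_ +] /setIP[_]].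
rewrite in_set in_set1 in_set in_set1 => /eqP -> /eqP e.
by have := mid_kk k_gt0; rewrite {1}e addNr (negbTE (mid0 k)).
Qed.

Lemma card_UVW : (0 < k)%N -> (#|U| + #|V| + #|W|)%N = #|X|.
Proof.
move=> k_gt0; rewrite -(cardsID (phi @^-1: [set k%:R] :|: phi @^-1: [set - k%:R]) X).
congr (_ + _)%N; rewrite setIUr -cardsUI (disjoint_setI0 (disjointUV k_gt0)).
by rewrite cards0 addn0.
Qed.

Lemma single_ge : (#|X| * K <= triples X M M)%N.
Proof.
apply: triples_ge => x; rewrite in_setD mem_middle_set => /andP[nMx _].
by rewrite card_middle_pairs leq_pmull // mid_count_ge1.
Qed.

Lemma single_geW : (0 < k)%N -> (#|X| * K + #|W| * K <= triples X M M)%N.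
Proof.
move=> k_gt0; pose T := phi @^-1: [set k%:R] :|: phi @^-1: [set - k%:R].
have dXT : [disjoint X :&: T & W].
  rewrite -setI_eq0; apply/eqP/setP => x; rewrite in_set0 in_setI in_setI [x \in W]in_setD.
  by case: (x \in T); rewrite ?andbF.
have le1 : (#|X :&: T| * K <= triples (X :&: T) M M)%N.
  apply: triples_ge => x /setIP[]; rewrite in_setD mem_middle_set => /andP[nMx _] _.
  by rewrite card_middle_pairs leq_pmull // mid_count_ge1.
have le2 : (#|W| * (2 * K) <= triples W M M)%N.
  apply: triples_ge => x /setDP[/setDP[_ nMx]].
  rewrite in_setU in_set in_set1 in_set in_set1 negb_or => /andP[xk xNk].
  rewrite mem_middle_set in nMx.
  by rewrite card_middle_pairs leq_mul2r mid_count_ge2 ?orbT.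
have := triplesUl M M dXT; rewrite setID => ->; have := cardsID T X.
move: le1 le2; rewrite -/T; move: #|X :&: T| #|W| #|X| K => a b c K'; nia.
Qed.

(** Both [k + k] and [- k - k] are middle classes, and so are the differences
    of [k] and [- k]: an ordered pair within [U] or within [V] gives one triple
    with a third element in [M], while each pair of an element of [U] and one of
    [V] gives four. *)
Lemma pairs_ge : (0 < k)%N ->
  (#|U| * #|U| + #|V| * #|V| + 4 * (#|U| * #|V|)
     <= triples X X M + 2 * triples X M X)%N.
Proof.
move=> k_gt0; have dUV := disjointUV k_gt0.
have phiU x : x \in U -> phi x = k%:R by move=> /setIP[_]; rewrite in_set in_set1 => /eqP.
have phiV x : x \in V -> phi x = - k%:R.
  by move=> /setIP[_]; rewrite in_set in_set1 => /eqP.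
have sUV : U :|: V \subset X by rewrite subUset !subsetIl.
have UUM : triples U U M = (#|U| * #|U|)%N.
  apply: triples_full => x y /phiU ex /phiU ey.
  by rewrite mem_middle_set raddfD ex ey mid_kk.
have VVM : triples V V M = (#|V| * #|V|)%N.
  apply: triples_full => x y /phiV ex /phiV ey.
  by rewrite mem_middle_set raddfD ex ey -opprD oppr_mid mid_kk.
have UMV : triples U M V = (#|U| * #|V|)%N.
  apply: triples_full_r => x y /phiU ex /phiV ey.
  by rewrite mem_middle_set raddfB ex ey -opprD oppr_mid mid_kk.
have VMU : triples V M U = (#|V| * #|U|)%N.
  apply: triples_full_r => x y /phiV ex /phiU ey.
  by rewrite mem_middle_set raddfB ex ey opprK mid_kk.
have le1 : (triples U U M + triples V V M <= triples X X M)%N.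
  apply: leq_trans (triples_sub sUV (subxx X) (subxx M)).
  by rewrite triplesUl // leq_add // triples_sub ?subsetIl.
have le2 : (triples U M V + triples V M U <= triples X M X)%N.
  apply: leq_trans (triples_sub sUV (subxx M) (subxx X)).
  by rewrite triplesUl // leq_add // triples_sub ?subsetIl.
by move: le1 le2; rewrite UUM VVM UMV VMU [(#|V| * #|U|)%N]mulnC; lia.
Qed.

Lemma ST_lower_bound :
  (3 * (#|X| * K) + triples X X X <= ST A + 9 * (#|X| * #|Y|))%N.
Proof.
have := triples_exchange A M; rewrite /= [triples M M X]triples_opp.
rewrite oppset_middle_set -(ST_triples A); have := single_ge.
move: (#|X| * K)%N (#|X| * #|Y|)%N (triples X M M) => a b c. lia.
Qed.

Lemma ST_lower_bound_pairs : (0 < k)%N ->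
  (3 * (#|X| * K) + 3 * (#|W| * K) + #|X| * #|X| + 2 * (#|U| * #|V|)
     + triples X X X <= ST A + 9 * (#|X| * #|Y|) + 2 * (#|X| * #|W|))%N.
Proof.
move=> k_gt0; have := triples_exchange A M; rewrite /= [triples M M X]triples_opp.
rewrite oppset_middle_set -(ST_triples A).
have := single_geW k_gt0; have := pairs_ge k_gt0; have := card_UVW k_gt0.
move: (ST A) (triples X M M) (triples X X M) (triples X M X) (triples X X X).
move: K #|U| #|V| #|W| #|X| #|Y| => K' u v w x y s s1 s2 s3 s4 <-; nia.
Qed.

End LowerBound.

End MiddleSets.

(** * Elements of low degree *)

Section LowDegree.
Variable G : finZmodType.
Implicit Types A : {set G}.

(** The threshold [m / 3] is such that three of these degrees add up to less
    than [m]. *)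
Definition low_degree A (m : nat) : {set G} :=
  [set z in A | (3 * #|[set b in A | (z + b)%R \in A]| < m)%N].

(** If [x], [y] and [x + y] were all of low degree, then [A], [x + A] and
    [x + y + A] would almost be pairwise disjoint, and [G] has no room for that. *)
Lemma low_degree_sum_free A m : (#|G| + m <= 3 * #|A|)%N -> sum_free (low_degree A m).
Proof.
move=> leA x y z; rewrite !in_set => /andP[Ax dx] /andP[Ay dy] /andP[Az dz] exyz.
have deg w : #|[set b in A | w + b \in A]| = #|A :&: shift w A|.
  rewrite -(card_shift w); congr #|pred_of_set _|; apply/setP => u.
  by rewrite mem_shift in_set in_setI mem_shift [w + _]addrC subrK andbC.
rewrite !deg in dx dy dz.
have cxz : #|shift x A :&: shift z A| = #|A :&: shift y A|.
  rewrite -(card_shift x (A :&: shift y A)); congr #|pred_of_set _|; apply/setP => u.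
  by rewrite !mem_shift !in_setI !mem_shift -exyz opprD addrA.
have := cardsUI A (shift x A); have := cardsUI (A :|: shift x A) (shift z A).
have : (#|(A :|: shift x A) :&: shift z A| <= #|A :&: shift z A| + #|A :&: shift y A|)%N.
  by rewrite setIUl -cxz -cardsUI leq_addr.
have : (#|A :|: shift x A :|: shift z A| <= #|G|)%N by apply: max_card.
by rewrite !card_shift; move: leA dx dy dz; card_lia.
Qed.

Lemma card_high_degree A m : (#|A :\: low_degree A m| * m <= 3 * ST A)%N.
Proof.
have /leq_trans-> // : (#|A :\: low_degree A m| * m
    <= 3 * triples (A :\: low_degree A m) A A)%N.
  rewrite -sum_nat_const /triples big_distrr; apply: leq_sum => z /setDP[Az].
  by rewrite in_set Az -leqNgt.
by rewrite ST_triples leq_mul2l triples_sub ?subsetDl.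
Qed.

End LowDegree.

(** The final comparison.  Here [m = n / p], [K = n / q], the sets [X], [Y] and
    [W] have [x], [y] and [w] elements, [s] is the number of Schur triples and
    [T] the number of those inside [X].  After the substitution
    [3 x = 3 y + 3 t + D] the terms [D * K], [3 * y * K] and [3 * w * K] of the
    lower bound outweigh [3 * t * D], [9 * x * y] and [2 * x * w]. *)
Lemma excess_arith (m K D t x y w uv T s : nat) : (m = K + D)%N ->
  (3 * x = 3 * y + 3 * t + D)%N -> (3 * x < K)%N -> (3 * t < K)%N ->
  (s <= 3 * (t * m) + t * t)%N ->
  (3 * (x * K) + 3 * (w * K) + x * x + 2 * uv + T <= s + 9 * (x * y) + 2 * (x * w))%N ->
  [/\ D = 0, y = 0, w = 0, uv = 0 & T = 0]%N.
Proof.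
move=> -> ex ltx ltt les low.
have h1 : (D * (3 * t).+1 <= D * K)%N by rewrite leq_mul2l ltt orbT.
have h2 : (y * (3 * x).+1 <= y * K)%N by rewrite leq_mul2l ltx orbT.
have h3 : (w * (3 * x).+1 <= w * K)%N by rewrite leq_mul2l ltx orbT.
have h4 : (t * t <= x * x)%N by rewrite leq_mul //; lia.
have h5 : (3 * (x * K) = 3 * (y * K) + 3 * (t * K) + D * K)%N.
  by rewrite !mulnA -!mulnDl ex.
have h6 : (D + y + w + uv + T <= 0)%N.
  move: low les h1 h2 h3 h4 h5; lia.
by split; lia.
Qed.

(** The same comparison for [p = 2], where pairs of elements of [X] are not
    counted on either side. *)
Lemma excess_arith2 (m K D t x y T s : nat) : (m = K + D)%N ->
  (3 * x = 3 * y + 3 * t + D)%N -> (3 * x < K)%N -> (3 * t < K)%N ->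
  (s <= 3 * (t * m))%N ->
  (3 * (x * K) + T <= s + 9 * (x * y))%N ->
  [/\ D = 0, y = 0 & T = 0]%N.
Proof.
move=> -> ex ltx ltt les low.
have h1 : (D * (3 * t).+1 <= D * K)%N by rewrite leq_mul2l ltt orbT.
have h2 : (y * (3 * x).+1 <= y * K)%N by rewrite leq_mul2l ltx orbT.
have h5 : (3 * (x * K) = 3 * (y * K) + 3 * (t * K) + D * K)%N.
  by rewrite !mulnA -!mulnDl ex.
have h6 : (D + y + T <= 0)%N.
  move: low les h1 h2 h5; lia.
by split; lia.
Qed.

(** The number [z] of elements of high degree is at most [9 t + 3 t^2 / m],
    which is less than [m / 11] because [t] is at most [m / 100]. *)
Lemma few_high_arith (m t z s : nat) : (0 < m)%N -> (100 * t <= m)%N ->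
  (s <= 3 * (t * m) + t * t)%N -> (z * m <= 3 * s)%N -> (11 * z <= m)%N.
Proof.
move=> m_gt0 ltm les lez; rewrite -(leq_pmul2r m_gt0).
have h1 : (100 * t * m <= m * m)%N by rewrite leq_mul2r ltm orbT.
have h2 : (100 * t * t <= m * t)%N by rewrite leq_mul2r ltm orbT.
lia.
Qed.

(** * Extremal sets *)

(** Both [3 * a = g + m + 3 * t] and [3 * cM = g + K] are instances of the
    relation between an interval of residues and its modulus. *)
Lemma excess_card (a b x y g cM m K D t k k0 : nat) : (a = k0.+1 * m + t)%N ->
  (cM = k.+1 * K)%N -> (g = (3 * k0 + 2) * m)%N -> (g = (3 * k + 2) * K)%N ->
  (b + x = a)%N -> (b + y = cM)%N -> (m = K + D)%N -> (3 * x = 3 * y + 3 * t + D)%N.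
Proof. lia. Qed.

Lemma standard_of_extremal k0 (G : finZmodType) (A : {set G}) m t :
    typeI (3 * k0 + 2) G -> (#|G| = (3 * k0 + 2) * m)%N ->
    (#|A| = k0.+1 * m + t)%N -> (100 * t <= m)%N ->
    (ST A = 3 * (t * m) + (0 < k0) * (t * t))%N ->
  exists (phi : {additive G -> 'Z_(3 * k0 + 2)}) (A' : {set G}),
    [/\ forall u, exists x, phi x = u, A' \subset phi @^-1: [set k0%:R],
        sum_free A', #|A'| = t
      & A = phi @^-1: middle_residues (3 * k0 + 2) k0 :|: A'].
Proof.
move=> GI cG cA tm eST.
have m_gt0 : (0 < m)%N.
  have : (0 < #|G|)%N by apply/card_gt0P; exists 0.
  by rewrite cG muln_gt0 => /andP[].
pose A0 := low_degree A m; pose z := #|A :\: A0|.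
have sA0 : A0 \subset A by apply/subsetP => x; rewrite in_set => /andP[].
have cA0 : (#|A0| + z = #|A|)%N by rewrite -(cardsID A0 A) (setIidPr sA0).
have zm : (11 * z <= m)%N.
  apply: few_high_arith m_gt0 tm _ (card_high_degree A m).
  by rewrite eST leq_add2l; case: (0 < k0)%N; rewrite ?mul0n ?mul1n.
have A0sf : sum_free A0.
  by apply: low_degree_sum_free; rewrite cG cA; lia.
have [|k [phi [prq leq surj sA0M]]] := sum_free_typeI GI A0sf.
  rewrite cG; have -> : #|A0| = (k0.+1 * m + t - z)%N by lia.
  by move: zm tm m_gt0; clear; nia.
set M := phi @^-1: _ in sA0M.
have cM := card_middle_set surj; rewrite -/M in cM.
have cGK := card_fibre_mul surj.
set K := #|phi @^-1: [set 0]| in cM cGK.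
have leKm : (K <= m)%N.
  rewrite -(leq_pmul2l (_ : 0 < 3 * k + 2)%N); last by lia.
  by rewrite -cGK cG leq_mul2r leq orbT.
have [D eD] : exists D, (m = K + D)%N by exists (m - K)%N; lia.
have xz : (#|A :\: M| <= z)%N by rewrite subset_leq_card // setDS.
have eAM := cardsID M A; have eMA := cardsID A M; rewrite setIC in eMA.
have le0 := subset_leq_card sA0M.
have e3 : (3 * #|A :\: M| = 3 * #|M :\: A| + 3 * t + D)%N.
  exact: excess_card cA cM cG cGK eAM eMA eD.
have leK : (m + 3 * t <= K + 3 * z)%N.
  have le0' : (#|A0| <= k.+1 * K)%N by rewrite -cM.
  by move: cA0 cA cG cGK le0'; move: #|A0| #|A| #|G| => *; lia.
have [ltxK lttK] : (3 * #|A :\: M| < K)%N /\ (3 * t < K)%N.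
  by move: xz; move: #|A :\: M| => x xz; split; lia.
have qp : D = 0%N -> k = k0.
  move=> D0; have : ((3 * k + 2) * m = (3 * k0 + 2) * m)%N.
    by rewrite -cG cGK eD D0 addn0.
  by move/eqP; rewrite eqn_pmul2r //; lia.
have final (D0 : D = 0%N) (y0 : #|M :\: A| = 0%N)
    (T0 : triples (A :\: M) (A :\: M) (A :\: M) = 0%N) :
    A :\: M \subset phi @^-1: [set k%:R] \/ A :\: M \subset phi @^-1: [set - k%:R] ->
  exists (phi : {additive G -> 'Z_(3 * k + 2)}) (A' : {set G}),
    [/\ forall u, exists x, phi x = u, A' \subset phi @^-1: [set k%:R],
        sum_free A', #|A'| = t
      & A = phi @^-1: middle_residues (3 * k + 2) k :|: A'].
  have eA : A = M :|: (A :\: M).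
    have MA : M \subset A by rewrite -setD_eq0 -cards_eq0 y0.
    by rewrite -{1}(setID A M) (setIidPr MA).
  have cX : #|A :\: M| = t by move: e3; rewrite y0 D0; lia.
  case=> sX; first by exists phi, (A :\: M); split=> //; apply: sum_free_triples.
  have [|psi epsi] := @exists_additive G 'Z_(3 * k + 2) (fun x => - phi x).
    by move=> x y; rewrite raddfD opprD.
  exists psi, (A :\: M); split=> //; last 1 first.
  - have -> : psi @^-1: middle_residues (3 * k + 2) k = M; last exact: eA.
    by apply/setP => x; rewrite !mem_middle_set epsi oppr_mid.
  - by move=> u; have [x ex] := surj (- u); exists x; rewrite epsi ex opprK.
  - apply/subsetP => x /(subsetP sX); rewrite !in_set !in_set1 epsi => /eqP ->.
    by rewrite opprK.
  - exact: sum_free_triples.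
have eq_k : (0 < k0)%N = (0 < k)%N.
  have [D1|D1] := posnP D; first by rewrite (qp D1).
  apply/idP/idP => [k0_gt0|k_gt0]; first by lia.
  rewrite lt0n; apply: contraTneq k_gt0 => e0.
  have : ((3 * k + 2) * K = 2 * m)%N by rewrite -cGK cG e0.
  have : (11 * m <= 11 * K + 33 * z)%N by lia.
  move=> h1 h2; rewrite -leqNgt leqNgt; apply/negP => k_gt0.
  have : (5 * K <= (3 * k + 2) * K)%N by rewrite leq_mul2r; apply/orP; right; lia.
  by lia.
rewrite eq_k in eST; have [k_gt0|k0'] := ltnP 0 k; last first.
  have leS : (ST A <= 3 * (t * m))%N by rewrite eST ltnNge k0' addn0.
  have [D0 y0 T0] := excess_arith2 eD e3 ltxK lttK leS (ST_lower_bound surj A).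
  rewrite -(qp D0); apply: (final D0 y0 T0); left.
  apply/subsetP => x; rewrite in_setD mem_middle_set mem_mid => /andP[nMx _].
  have ltx := Zq_ltn (phi x).
  rewrite in_set in_set1; apply/eqP; rewrite -(natr_Zp (phi x)); congr _%:R; lia.
have leS : (ST A <= 3 * (t * m) + t * t)%N by rewrite eST k_gt0 mul1n.
have := ST_lower_bound_pairs surj A k_gt0.
move=> /(excess_arith eD e3 ltxK lttK leS) [D0 y0 w0 uv0 T0].
rewrite -(qp D0); apply: (final D0 y0 T0).
have := card_UVW phi A k_gt0; rewrite w0 addn0 => cUV.
have sub S : #|(A :\: M) :&: S| = #|A :\: M| -> A :\: M \subset S.
  by move=> e; apply/setIidPl/eqP; rewrite eqEcard subsetIl e leqnn.
move/eqP: uv0; rewrite muln_eq0 => /orP[/eqP u0|/eqP v0]; [right|left]; apply: sub.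
  by rewrite -cUV u0.
by rewrite -cUV v0 addn0.
Qed.

(** * Standard sets *)

Theorem mainTheorem3 (R : realType) :
  (forall (p k : nat) (G : finZmodType),
     prime p -> p = 2 %[mod 3] -> p = (3 * k + 2)%N -> typeI p G ->
     forall t : nat, t%:R <= 2 * #|G|%:R / (7 * p%:R) :> R ->
     forall A : {set G}, standard_set R p k t A ->
       (ST A)%:R = 3 * t%:R * #|G|%:R / p%:R + ((p != 2)%N)%:R * t%:R ^+ 2 :> R)
  /\
  (exists delta : R, 0 < delta /\
     forall (p k : nat) (G : finZmodType),
     prime p -> p = 2 %[mod 3] -> p = (3 * k + 2)%N -> typeI p G ->
     forall t : nat, t%:R <= delta * #|G|%:R / p%:R ->
     forall A : {set G},
       #|A|%:R = (1 / 3 + 1 / (3 * p%:R)) * #|G|%:R + t%:R :> R ->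
       (ST A)%:R = 3 * t%:R * #|G|%:R / p%:R + ((p != 2)%N)%:R * t%:R ^+ 2 :> R ->
       standard_set R p k t A).
Proof.
split.
  move=> p k G prp p3 ep _ t _ A [_ [phi [A' [surj sA' A'sf cA' ->]]]].
  subst p; rewrite (ST_middle_union surj sA' A'sf) cA' (card_fibre_mul surj).
  have -> : (3 * k + 2 != 2)%N = (0 < k)%N by lia.
  have q_n0 : (3 * k + 2)%:R != 0 :> R by rewrite pnatr_eq0; lia.
  rewrite (natrM _ (3 * k + 2)); move: ((3 * k + 2)%:R : R) q_n0 => q q_n0.
  by rewrite natrD !natrM; field; exact: q_n0.
(* With [t] at most [m / 100], at most [m / 11] elements of [A] have high
   degree; this gives all the margins. *)
exists (1 / 100); split; first by lra.
move=> p k G prp _ ep GI t let_ A cA eST; subst p.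
have [_ _ /dvdnP[m cG] _] := GI; rewrite mulnC in cG.
have q_n0 : (3 * k + 2)%:R != 0 :> R by rewrite pnatr_eq0; lia.
have Gp (c : R) : c * #|G|%:R / (3 * k + 2)%:R = c * m%:R.
  by rewrite cG natrM; move: ((3 * k + 2)%:R : R) q_n0 => q q_n0; field; exact: q_n0.
rewrite Gp in let_; rewrite Gp in eST.
have {cA} cA' : #|A| = (k.+1 * m + t)%N.
  apply/eqP; rewrite -(eqr_nat R) cA cG; apply/eqP.
  have -> : (k.+1 * m + t)%:R = ((3 * k + 2)%:R + 1) / 3 * m%:R + t%:R :> R.
    by rewrite natrD natrM -[k.+1]addn1 !(natrD, natrM); field.
  by rewrite natrM; move: ((3 * k + 2)%:R : R) q_n0 => q q_n0; field; exact: q_n0.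
have {eST} eST' : ST A = (3 * (t * m) + (0 < k) * (t * t))%N.
  apply/eqP; rewrite -(eqr_nat R) eST; apply/eqP.
  have -> : (3 * k + 2 != 2)%N = (0 < k)%N by lia.
  by rewrite !(natrD, natrM); ring.
have tm : (100 * t <= m)%N.
  by rewrite -(ler_nat R) natrM; lra.
split; last exact: standard_of_extremal GI cG cA' tm eST'.
have -> : 2 * #|G|%:R / (7 * (3 * k + 2)%:R) = 2 / 7 * m%:R :> R.
  by rewrite cG natrM; move: ((3 * k + 2)%:R : R) q_n0 => q q_n0; field; exact: q_n0.
have : (0 : R) <= m%:R by rewrite ler0n.
by lra.
Qed.
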